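(* Let $p$ be an odd prime, $a\ge0$ an integer and $\lambda=(a,0,-a)$. With the vectors $f^{a,j}$ ($0\le j\le a$), the element $u$, the character $\nu_1$ and the normalised action $\tau^{-n}\ast$ on $V_{\lambda,\mathbb{Z}_p}$ defined in the context, for all $0\le k\le a$ and all $n\ge1$ we have $$\sum_{j=0}^k\binom{k}{j}(-1)^j\,\tau^{-n}\ast\left(u^{-1}\cdot\nu_1^jf^{a,j}\right)\equiv0\bmod p^{nk}$$ in $V_{\lambda,\mathbb{Z}_p}$, i.e. the left-hand side lies in $p^{nk}V_{\lambda,\mathbb{Z}_p}$.
   Context: $G=\mathrm{GL}_3\times\mathrm{GL}_1$, $H=\mathrm{GL}_2\times\mathrm{GL}_1$, embedded by $\iota(A,e)=(\mathrm{diag}(A,e),e)$. The character $\nu_1$ of $G$ is $\nu_1((B,t))=\det B/t^2$; on $H$ it restricts to $\nu_1((A,z))=\det A/z$. $P_1\subset\mathrm{GL}_3$ is the block upper triangular parabolic with Levi $L_1=\mathrm{GL}_1\times\mathrm{GL}_2$, $\bar N_1$ is the unipotent radical of the opposite parabolic, and $L_1^G=L_1\times\mathrm{GL}_1$. $Q_H^0\subset H$ is the subgroup of elements $\begin{pmatrix}x&y\\0&1\end{pmatrix}\times(z)$. Let $$u=\begin{pmatrix}1&0&1\\0&1&0\\0&0&1\end{pmatrix}\begin{pmatrix}1&0&0\\0&0&-1\\0&1&0\end{pmatrix}\in\mathrm{GL}_3(\mathbb{Z}),\qquad\tau=\mathrm{diag}(p,1,1)\in\mathrm{GL}_3(\mathbb{Q}_p),$$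 regarded as elements of $G$ with trivial $\mathrm{GL}_1$-component. $W_{\lambda,\mathbb{Z}_p}$ is the $L_1$-representation $x^a\boxtimes(\mathrm{Sym}^a\mathbb{Z}_p^2\otimes\det^{-a})$ (highest weight $(a,0,-a)$; the extra $\mathrm{GL}_1$ acts trivially), with maximal admissible lattice structure, and $w_\lambda^-$ is a fixed generator of its lowest weight space (weight $(a,-a,0)$). For $j\ge0$, $V_{\lambda,\mathbb{Z}_p}\otimes\nu_1^{-j}$ is identified (Borel--Weil) with the $\mathbb{Z}_p$-module of regular functions $f$ on $G_{/\mathbb{Z}_p}$ with values in $W_{\lambda,\mathbb{Z}_p}$ satisfying $f(\bar n\ell g)=\nu_1^{-j}(\ell)\,\ell\cdot f(g)$ for $\bar n\in\bar N_1$, $\ell\in L_1^G$, with $G$ acting by $(\gamma\cdot f)(g)=f(g\gamma)$; for $j=0$ this is the maximal admissible lattice $V_{\lambda,\mathbb{Z}_p}$ in the irreducible representation $V_\lambda$ of $\mathrm{GL}_3$ of highest weight $\lambda$. For $0\le j\le a$, $f^{a,j}\in V_{\lambda,\mathbb{Z}_p}\otimes\nu_1^{-j}$ is the unique $Q_H^0$-invariant element (i.e. $f^{a,j}(gq)=f^{a,j}(g)$ for $q\in Q_H^0$) with $f^{a,j}(u^{-1})=w_\lambda^-$. The product function $\nu_1^jf^{a,j}$ is an element of $V_{\lambda,\mathbb{Z}_p}$. On $V_\lambda$ set $\tau^{-1}\ast v:=p^a\,\tau^{-1}\cdot v$ (so $\tau^{-n}\ast v=p^{an}\tau^{-n}\cdot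 v$); this preserves $V_{\lambda,\mathbb{Z}_p}$. *)

(* Defs.v *)
From HB Require Import structures.
From mathcomp Require Import all_boot all_order all_algebra.
From mathcomp Require Import boolp.
From mathcomp Require Import mpoly.
Set Implicit Arguments.
Unset Strict Implicit.
Unset Printing Implicit Defensive.

Import Order.TTheory GRing.Theory Num.Theory.
Local Open Scope ring_scope.

(* The ring Z_p as the inverse limit of the Z/p^n: [approx x n] is the
   representative in [0, p^n) of the class of x modulo p^n.  The bound is part
   of [approxP], since the right-hand side is a remainder modulo p^n. *)
Record padic_int (p : nat) (p_pr : prime p) : Type := PadicInt {
  approx : nat -> int;
  approxP : forall n, approx n = (approx n.+1 %% (p ^ n)%N%:Z)%Z
}.

Section PadicInt.
Variables (p : nat) (p_pr : prime p).
Local Notation Zp := (padic_int p_pr).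
Local Notation m n := ((p ^ n)%N%:Z).

HB.instance Definition _ := gen_eqMixin Zp.
HB.instance Definition _ := gen_choiceMixin Zp.

Lemma padic_eq (x y : Zp) : (forall n, approx x n = approx y n) -> x = y.
Proof.
case: x y => [x xP] [y yP] /= /funext exy.
by case: y / exy yP => yP; congr PadicInt; apply: Prop_irrelevance.
Qed.

Lemma approx_mod (x : Zp) n : (approx x n %% m n)%Z = approx x n.
Proof. by rewrite approxP modz_mod. Qed.

Definition coherent (s : nat -> int) := forall n, (s n = s n.+1 %[mod m n])%Z.

Lemma modp_modpS k n : ((k %% m n.+1)%Z = k %[mod m n])%Z.
Proof.
apply/eqP; rewrite eqz_mod_dvd {2}(divz_eq k (m n.+1)) opprD addrCA subrr addr0.
by rewrite rpredN dvdz_mull // expnS PoszM dvdz_mull.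
Qed.

Lemma padic_of_proof s (sP : coherent s) n :
  (s n %% m n)%Z = ((s n.+1 %% m n.+1)%Z %% m n)%Z.
Proof. by rewrite modp_modpS. Qed.

Definition padic_of s (sP : coherent s) : Zp :=
  @PadicInt p p_pr (fun n => (s n %% m n)%Z) (padic_of_proof sP).

Lemma approx_coherent (x : Zp) : coherent (approx x).
Proof. by move=> n; rewrite {1}approxP modz_mod. Qed.

Lemma padic_int_proof (k : int) : coherent (fun=> k).
Proof. by []. Qed.

Lemma padic_opp_proof (x : Zp) : coherent (fun n => - approx x n).
Proof. by move=> n; rewrite (approxP x n) modzNm. Qed.

Lemma padic_add_proof (x y : Zp) : coherent (fun n => approx x n + approx y n).
Proof. by move=> n; rewrite (approxP x n) (approxP y n) modzDm. Qed.

Lemma padic_mul_proof (x y : Zp) : coherent (fun n => approx x n * approx y n).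
Proof. by move=> n; rewrite (approxP x n) (approxP y n) modzMm. Qed.

Definition padic_zero : Zp := padic_of (padic_int_proof 0).
Definition padic_one : Zp := padic_of (padic_int_proof 1).
Definition padic_opp (x : Zp) : Zp := padic_of (padic_opp_proof x).
Definition padic_add (x y : Zp) : Zp := padic_of (padic_add_proof x y).
Definition padic_mul (x y : Zp) : Zp := padic_of (padic_mul_proof x y).

Lemma padic_addA : associative padic_add.
Proof.
by move=> x y z; apply: padic_eq => n /=; rewrite modzDml modzDmr addrA.
Qed.

Lemma padic_addC : commutative padic_add.
Proof. by move=> x y; apply: padic_eq => n /=; rewrite addrC. Qed.

Lemma padic_add0 : left_id padic_zero padic_add.
Proof.
by move=> x; apply: padic_eq => n /=; rewrite modzDml add0r approx_mod.
Qed.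

Lemma padic_addN : left_inverse padic_zero padic_opp padic_add.
Proof. by move=> x; apply: padic_eq => n /=; rewrite modzDml addNr. Qed.

HB.instance Definition _ := GRing.isZmodule.Build Zp
  padic_addA padic_addC padic_add0 padic_addN.

Lemma padic_mulA : associative padic_mul.
Proof.
by move=> x y z; apply: padic_eq => n /=; rewrite modzMml modzMmr mulrA.
Qed.

Lemma padic_mulC : commutative padic_mul.
Proof. by move=> x y; apply: padic_eq => n /=; rewrite mulrC. Qed.

Lemma padic_mul1 : left_id padic_one padic_mul.
Proof.
by move=> x; apply: padic_eq => n /=; rewrite modzMml mul1r approx_mod.
Qed.

Lemma padic_mulDl : left_distributive padic_mul padic_add.
Proof.
by move=> x y z; apply: padic_eq => n /=; rewrite modzMml modzDm mulrDl.
Qed.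

Lemma padic_one_neq0 : padic_one != padic_zero.
Proof.
apply/eqP => /(congr1 (fun x => approx x 1)) /=.
by rewrite expn1 mod0z modz_small // ltz_nat prime_gt1.
Qed.

HB.instance Definition _ := GRing.Zmodule_isComNzRing.Build Zp
  padic_mulA padic_mulC padic_mul1 padic_mulDl padic_one_neq0.

Definition padic_unit : {pred Zp} := fun x => `[< exists y : Zp, y * x = 1 >].

Definition padic_inv (x : Zp) : Zp :=
  if pselect (exists y : Zp, y * x = 1) is left ex then projT1 (cid ex) else x.

Lemma padic_mulV : {in padic_unit, left_inverse 1 padic_inv *%R}.
Proof.
move=> x /asboolP ux; rewrite /padic_inv; case: pselect => // ex.
by case: (cid ex).
Qed.

Lemma padic_unitP (x y : Zp) : y * x = 1 -> padic_unit x.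
Proof. by move=> yx1; apply/asboolP; exists y. Qed.

Lemma padic_inv_out : {in [predC padic_unit], padic_inv =1 id}.
Proof.
move=> x nux; rewrite /padic_inv; case: pselect => // ux.
by case/negP: nux; apply/asboolP.
Qed.

HB.instance Definition _ := GRing.ComNzRing_hasMulInverse.Build Zp
  padic_mulV padic_unitP padic_inv_out.

Lemma approxD (x y : Zp) n :
  approx (x + y) n = ((approx x n + approx y n) %% m n)%Z.
Proof. by []. Qed.

Lemma approxM (x y : Zp) n :
  approx (x * y) n = ((approx x n * approx y n) %% m n)%Z.
Proof. by []. Qed.

Lemma approx_nat (k n : nat) : approx (k%:R : Zp) n = (k%:Z %% m n)%Z.
Proof.
elim: k => [|k IHk] //.
by rewrite mulrS approxD IHk modzDm -PoszD add1n.
Qed.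

Lemma approx_shift (x : Zp) n k : (approx x (n + k) = approx x n %[mod m n])%Z.
Proof.
elim: k => [|k IHk]; first by rewrite addn0.
rewrite -IHk addnS (approxP x (n + k)); apply/esym/eqP.
rewrite eqz_mod_dvd {2}(divz_eq (approx x (n + k).+1) (m (n + k))).
by rewrite opprD addrCA subrr addr0 rpredN expnD PoszM dvdz_mull // dvdz_mulr.
Qed.

Lemma padic_neq0P (x : Zp) :
  x != 0 -> exists n, forall k, ~~ (m n %| approx x (n + k))%Z.
Proof.
move=> x0; case: (pselect (exists n, approx x n <> 0)) => [[n xn]|no].
  exists n => k; apply/negP => /dvdz_mod0P.
  by rewrite approx_shift approx_mod.
case/eqP: x0; apply: padic_eq => n /=; rewrite mod0z.
by apply: contrapT => xn; apply: no; exists n.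
Qed.

Lemma ndvd_pfactor (b : int) k :
  ~~ (m k %| b)%Z -> (0 < `|b|)%N && (logn p `|b| < k)%N.
Proof.
move=> nd; have b0 : (0 < `|b|)%N.
  by rewrite absz_gt0; apply: contraNneq nd => ->; rewrite dvdz0.
by rewrite b0 ltnNge; apply: contra nd => le; rewrite dvdzE /= pfactor_dvdn.
Qed.

Lemma padic_idomain : GRing.integral_domain_axiom Zp.
Proof.
move=> x y xy0; apply/norP => -[/padic_neq0P[n xn] /padic_neq0P[k yk]].
have /andP[x0 xl] := ndvd_pfactor (xn k).
have := ndvd_pfactor (yk n); rewrite addnC => /andP[y0 yl].
have /dvdz_mod0P : approx (x * y) (n + k) = 0 by rewrite xy0 /= mod0z.
rewrite dvdzE /= abszM pfactor_dvdn ?muln_gt0 ?x0 ?y0 // lognM //.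
rewrite leqNgt => /negP[]; apply: leq_trans (leq_add xl yl).
by rewrite addSn addnS ltnS leqnSn.
Qed.

HB.instance Definition _ := GRing.ComUnitRing_isIntegral.Build Zp padic_idomain.

Lemma padic_p_neq0 : p%:R != 0 :> Zp.
Proof.
apply/eqP => /(congr1 (fun x => approx x 2)); rewrite approx_nat /= mod0z.
rewrite modz_small ?ltz_nat ?le0z_nat /=; last first.
  by rewrite -{1}(expn1 p) ltn_exp2l ?prime_gt1.
by case=> p0; move: (prime_gt0 p_pr); rewrite p0.
Qed.

End PadicInt.

Section UnitGroup.
Variable R : unitRingType.

Record units : Type := Units {
  unit_val : R;
  unit_valP : unit_val \is a GRing.unit
}.

HB.instance Definition _ := [isSub for unit_val].
HB.instance Definition _ := [Choice of units by <:].

Definition units_one : units := Units (unitr1 R).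

Lemma units_mul_proof (x y : units) : val x * val y \is a GRing.unit.
Proof. by rewrite unitrMr ?unit_valP. Qed.

Definition units_mul (x y : units) : units := Units (units_mul_proof x y).

Lemma units_inv_proof (x : units) : (val x)^-1 \is a GRing.unit.
Proof. by rewrite unitrV unit_valP. Qed.

Definition units_inv (x : units) : units := Units (units_inv_proof x).

Lemma units_mulA : associative units_mul.
Proof. by move=> x y z; apply: val_inj; rewrite /= mulrA. Qed.

Lemma units_mul1 : left_id units_one units_mul.
Proof. by move=> x; apply: val_inj; rewrite /= mul1r. Qed.

Lemma units_mulr1 : right_id units_one units_mul.
Proof. by move=> x; apply: val_inj; rewrite /= mulr1. Qed.

Lemma units_mulV : left_inverse units_one units_inv units_mul.
Proof. by move=> x; apply: val_inj; rewrite /= mulVr ?unit_valP. Qed.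

Lemma units_mulrV : right_inverse units_one units_inv units_mul.
Proof. by move=> x; apply: val_inj; rewrite /= divrr ?unit_valP. Qed.

HB.instance Definition _ :=
  isGroup.Build units units_mulA units_mul1 units_mulr1 units_mulV units_mulrV.

End UnitGroup.

(* The groups of K-points of G, H and L_1^G. *)
Notation GrpG K := (units 'M[K]_3 * units K)%type.
Notation GrpH K := (units 'M[K]_2 * units K)%type.
Notation LeviG K := (units K * units 'M[K]_2 * units K)%type.

Section Groups.
Variable K : fieldType.

Definition iota_mx (h : GrpH K) : 'M[K]_(2 + 1) :=
  block_mx (val h.1) 0 0 (val h.2)%:M.

Lemma iota_proof h : iota_mx h \in unitmx.
Proof.
rewrite unitmxE det_ublock det_scalar1 unitrM -unitmxE.
by apply/andP; split; [exact: (unit_valP h.1) | exact: unit_valP].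
Qed.

Definition iota (h : GrpH K) : GrpG K :=
  (@Units 'M[K]_3 (iota_mx h) (iota_proof h), h.2).

Definition levi_mx (l : LeviG K) : 'M[K]_(1 + 2) :=
  block_mx (val l.1.1)%:M 0 0 (val l.1.2 : 'M[K]_2).

Lemma levi_proof l : levi_mx l \in unitmx.
Proof.
rewrite unitmxE det_ublock det_scalar1 unitrM -unitmxE.
by apply/andP; split; [exact: unit_valP | exact: (unit_valP l.1.2)].
Qed.

Definition levi (l : LeviG K) : GrpG K :=
  (@Units 'M[K]_3 (levi_mx l) (levi_proof l), l.2).

Definition nbar_mx (c : 'cV[K]_2) : 'M[K]_(1 + 2) := block_mx 1%:M 0 c 1%:M.

Lemma nbar_proof c : nbar_mx c \in unitmx.
Proof. by rewrite unitmxE det_lblock !det1 mulr1 unitr1. Qed.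

(* The elements of the unipotent radical opposite to that of P_1. *)
Definition nbar (c : 'cV[K]_2) : GrpG K :=
  (@Units 'M[K]_3 (nbar_mx c) (nbar_proof c), 1%g).

Definition in_QH0 (h : GrpH K) : Prop :=
  val h.1 1 0 = 0 /\ val h.1 1 1 = 1.

Definition nu1 (g : GrpG K) : K := \det (val g.1) / val g.2 ^+ 2.

Definition mx3 (rows : seq (seq K)) : 'M[K]_3 :=
  \matrix_(i, j) nth 0 (nth [::] rows i) j.

Lemma mx3_unit (A B : seq (seq K)) : mx3 A * mx3 B = 1 -> mx3 A \in unitmx.
Proof. by case/mulmx1_unit. Qed.

Ltac mx3_tac :=
  by apply/matrixP => -[[|[|[|i]]] ?] // -[[|[|[|j]]] ?] //;
     rewrite !mxE !big_ord_recl big_ord0 !mxE /= ?(mulr0, mul0r, mulr1, mul1r,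
       addr0, add0r, mulrNN, subrr, addNr, mulVf, mulfV, oppr0) //.

Lemma u_unip_proof :
  mx3 [:: [:: 1; 0; 1]; [:: 0; 1; 0]; [:: 0; 0; 1]] \in unitmx.
Proof.
apply: (@mx3_unit _ [:: [:: 1; 0; -1]; [:: 0; 1; 0]; [:: 0; 0; 1]]).
mx3_tac.
Qed.

Lemma u_weyl_proof :
  mx3 [:: [:: 1; 0; 0]; [:: 0; 0; -1]; [:: 0; 1; 0]] \in unitmx.
Proof.
apply: (@mx3_unit _ [:: [:: 1; 0; 0]; [:: 0; 0; 1]; [:: 0; -1; 0]]).
mx3_tac.
Qed.

Definition u_elt : GrpG K :=
  ((@Units 'M[K]_3 _ u_unip_proof * @Units 'M[K]_3 _ u_weyl_proof)%g, 1%g).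

Lemma diag_proof (x : units K) :
  mx3 [:: [:: val x; 0; 0]; [:: 0; 1; 0]; [:: 0; 0; 1]] \in unitmx.
Proof.
have x0 : val x != 0 by rewrite -unitfE unit_valP.
apply: (@mx3_unit _ [:: [:: (val x)^-1; 0; 0]; [:: 0; 1; 0]; [:: 0; 0; 1]]).
mx3_tac.
Qed.

(* diag(x, 1, 1), so that tau is the case x = p. *)
Definition tau (x : units K) : GrpG K := (@Units 'M[K]_3 _ (diag_proof x), 1%g).

Definition rtrans (T : Type) (c : GrpG K) (f : GrpG K -> T) : GrpG K -> T :=
  fun g => f (g * c)%g.

(* The action of L_1^G on W = x^a [x] (Sym^a tensor det^-a): the space Sym^a of
   the standard representation is the space of homogeneous polynomials of
   degree a in 'X_0, 'X_1, standing for the two standard basis vectors, and A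
   maps 'X_i to the combination of 'X_0, 'X_1 given by the i-th column of A. *)
Definition actW (a : nat) (l : LeviG K) (w : {mpoly K[2]}) : {mpoly K[2]} :=
  let A : 'M_2 := val l.1.2 in
  (val l.1.1 ^+ a * \det A ^- a) *:
    comp_mpoly [tuple \sum_(k < 2) A k i *: 'X_k | i < 2] w.

(* The ten coordinates of g = (B, t): the entries of B, then t. *)
Definition coords (g : GrpG K) : 'I_(3 * 3 + 1) -> K :=
  row_mx (mxvec (val g.1)) (val g.2)%:M 0.

End Groups.

Section BorelWeil.
Variable R : idomainType.
Local Notation K := {fraction R}.
Local Notation G := (GrpG K).

(* The elements of R[G] = R[B, t][1 / (det B * t)], viewed as functions on
   G(K).  For R infinite this identification is faithful: R[G] embeds in K[G]
   and G(K) is Zariski dense in G_K.  For the same reason the equivariance and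
   invariance conditions below need only be imposed on K-points. *)
Definition regular (phi : G -> K) : Prop :=
  exists (P : {mpoly R[3 * 3 + 1]}) (N : nat), forall g : G,
    phi g = (map_mpoly (@tofrac R) P).@[coords g]
              / (\det (val g.1) * val g.2) ^+ N.

Definition W_lattice (a : nat) (w : {mpoly K[2]}) : Prop :=
  w \is (a.-homog) /\ exists w0 : {mpoly R[2]}, w = map_mpoly (@tofrac R) w0.

(* The part of the lattice of weight (a, -a, 0) for the diagonal torus. *)
Definition lowest_weight_space (a : nat) (w : {mpoly K[2]}) : Prop :=
  W_lattice a w /\
  forall l : LeviG K, is_diag_mx (val l.1.2) ->
    actW a l w = (val l.1.1 ^+ a * val l.1.2 0 0 ^- a) *: w.

Definition lowest_weight_generator (a : nat) (w : {mpoly K[2]}) : Prop :=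
  lowest_weight_space a w /\
  forall v, lowest_weight_space a v -> exists c : R, v = tofrac c *: w.

(* The Borel-Weil model over R of V_lambda tensor nu_1^-j, lambda = (a, 0, -a);
   a W-valued function is regular when its coefficients on monomials are. *)
Definition V_lattice (a j : nat) (f : G -> {mpoly K[2]}) : Prop :=
  [/\ forall g, f g \is (a.-homog),
      forall m, regular (fun g => (f g)@_m)
    & forall c l g,
        f (nbar c * levi l * g)%g = nu1 (levi l) ^- j *: actW a l (f g)].

(* The conditions characterising f^{a,j}, where w stands for w_lambda^-. *)
Definition is_f (a j : nat) (w : {mpoly K[2]}) (f : G -> {mpoly K[2]}) : Prop :=
  [/\ V_lattice a j f,
      forall q, in_QH0 q -> forall g, f (g * iota q)%g = f g
    & f (u_elt K)^-1%g = w].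

Definition nu1_mul (j : nat) (f : G -> {mpoly K[2]}) : G -> {mpoly K[2]} :=
  fun g => nu1 g ^+ j *: f g.

End BorelWeil.

Notation padic_rat p_pr := {fraction (padic_int p_pr)}.

Section PadicTau.
Variables (p : nat) (p_pr : prime p).
Local Notation Qp := (padic_rat p_pr).

Lemma p_unit_proof : (p%:R : Qp) \is a GRing.unit.
Proof. by rewrite unitfE -(rmorph_nat (@tofrac _)) tofrac_eq0 padic_p_neq0. Qed.

Definition p_unit : units Qp := Units p_unit_proof.

(* tau^-n * v = p^(an) tau^-n . v, with tau = diag(p, 1, 1). *)
Definition tau_star (a n : nat) (v : GrpG Qp -> {mpoly Qp[2]}) :
    GrpG Qp -> {mpoly Qp[2]} :=
  fun g => (p%:R ^+ (a * n) : Qp) *: rtrans (tau p_unit ^- n)%g v g.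

End PadicTau.

(* Main.v *)
From HB Require Import structures.
Require Import Defs.
From mathcomp Require Import all_boot all_order all_algebra.
From mathcomp Require Import ring.
From mathcomp Require Import mpoly.
Import GRing.Theory.
Local Open Scope ring_scope.

Set Implicit Arguments.
Unset Strict Implicit.
Unset Printing Implicit Defensive.

(* Write r for the first row of B and m_il for the vector of the two 2x2 minors
   of B formed from r and the second, resp. third, row in columns i, l, viewed
   as a linear form in 'X_0, 'X_1.  For covectors al, be on row space,
     c (r al)^e (r be)^(a-e) m_il^a / det^a
   has the equivariance required of elements of the lattice V_lambda.  As w is
   a multiple c 'X_1^a, one finds
     nu_1^j f^{a,j} = c (-1)^j r_1^j r_3^(a-j) m_12^a / det^a :
   when r_1 and r_3 are nonzero, g lies in bar N_1 L_1^G u^-1 Q_H^0, and any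
   other g is reached from this open set along a polynomial curve.  Substituting
   g tau^-n u^-1, whose columns are s b_1, -b_3 and b_2 - s b_1 with s = p^-n,
   the binomial theorem collapses the alternating sum to
     p^(nk) c (-1)^a r_2^k (p^n r_2 - r_1)^(a-k) m_13^a / det^a. *)

(** * Equivariant vectors built from the first row and its minors *)

Definition toprow (S : comNzRingType) (B : 'M[S]_3) : 'rV[S]_3 :=
  @usubmx S 1 2 3 B.
Definition bottomrows (S : comNzRingType) (B : 'M[S]_3) : 'M[S]_(2, 3) :=
  @dsubmx S 1 2 3 B.

Definition linform (S : comNzRingType) (v : 'cV[S]_2) : {mpoly S[2]} :=
  \sum_(i < 2) v i 0 *: 'X_i.

Definition minors (S : comNzRingType) (i j : 'I_3) (B : 'M[S]_3) : 'cV[S]_2 :=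
  toprow B 0 i *: col j (bottomrows B) - toprow B 0 j *: col i (bottomrows B).

Section BWNumerator.
Variables (a e : nat) (i j : 'I_3).

(** The base ring is arbitrary so that one numerator, formed for the generic matrix over a
    polynomial ring, specialises to all the others through [map_bw_num]. *)
Definition bw_num (S : comNzRingType) (c : S) (al be : 'cV[S]_3)
    (B : 'M[S]_3) : {mpoly S[2]} :=
  (c * (toprow B *m al) 0 0 ^+ e * (toprow B *m be) 0 0 ^+ (a - e))
    *: linform (minors i j B) ^+ a.

Lemma map_toprow (S T : comNzRingType) (phi : {rmorphism S -> T}) B :
  map_mx phi (toprow B) = toprow (map_mx phi B).
Proof. exact: map_usubmx. Qed.

Lemma map_linform (S T : comNzRingType) (phi : {rmorphism S -> T}) v :
  map_mpoly phi (linform v) = linform (map_mx phi v).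
Proof.
rewrite /linform raddf_sum; apply: eq_bigr => k _.
by rewrite /= map_mpolyZ map_mpolyX mxE.
Qed.

Lemma map_minors (S T : comNzRingType) (phi : {rmorphism S -> T}) B :
  map_mx phi (minors i j B) = minors i j (map_mx phi B).
Proof. by apply/matrixP=> k l; rewrite !mxE rmorphB !rmorphM. Qed.

Lemma map_bw_num (S T : comNzRingType) (phi : {rmorphism S -> T}) c al be B :
  map_mpoly phi (bw_num c al be B)
  = bw_num (phi c) (map_mx phi al) (map_mx phi be) (map_mx phi B).
Proof.
rewrite /bw_num map_mpolyZ rmorphXn /= map_linform map_minors.
by rewrite !rmorphM !rmorphXn -!map_toprow -!map_mxM !mxE.
Qed.

Lemma linformZ (S : comNzRingType) (x : S) v :
  linform (x *: v) = x *: linform v.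
Proof.
by rewrite scaler_sumr; apply: eq_bigr => k _; rewrite !mxE scalerA.
Qed.

Lemma linform_homog (S : comNzRingType) (v : 'cV[S]_2) :
  linform v \is 1.-homog.
Proof.
by apply: rpred_sum => k _; apply: dhomogZ; rewrite dhomogX /= mdeg1.
Qed.

Lemma bw_num_homog (S : comNzRingType) (c : S) al be B :
  bw_num c al be B \is (a.-homog).
Proof.
apply: dhomogZ; have := dhomogMn a (linform_homog (minors i j B)).
by rewrite mul1n.
Qed.

Lemma comp_linform (S : comNzRingType) (A : 'M[S]_2) v :
  comp_mpoly [tuple \sum_(k < 2) A k i *: 'X_k | i < 2] (linform v)
  = linform (A *m v).
Proof.
rewrite raddf_sum [RHS]/linform /=.
under eq_bigr => k _ do
  rewrite comp_mpolyZ comp_mpolyXU nth_mktuple scaler_sumr.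
rewrite exchange_big /=; apply: eq_bigr => k _ /=.
rewrite [in RHS]mxE scaler_suml; apply: eq_bigr => l _.
by rewrite scalerA mulrC.
Qed.

Lemma toprow_par (S : comNzRingType) (x : S) c (A : 'M_2) (B : 'M_3) :
  toprow ((block_mx x%:M 0 c A : 'M_(1 + 2)) *m B) = x *: toprow B.
Proof.
rewrite -[B in LHS](@vsubmxK S 1 2) mul_block_col /toprow col_mxKu.
by rewrite mul0mx addr0 mul_scalar_mx.
Qed.

(** The block [c] adds multiples of the first row to the lower rows, and these cancel in any 2x2
    minor that contains the first row. *)
Lemma minors_par (S : comNzRingType) (x : S) c (A : 'M_2) (B : 'M_3) :
  minors i j ((block_mx x%:M 0 c A : 'M_(1 + 2)) *m B)
  = x *: (A *m minors i j B).
Proof.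
rewrite /minors toprow_par /bottomrows.
rewrite -[B in dsubmx (_ *m B)](@vsubmxK S 1 2) mul_block_col col_mxKd.
rewrite /toprow; move: (@usubmx S 1 2 3 B) (@dsubmx S 1 2 3 B) => r D.
have colD l : col l (c *m r + A *m D) = r 0 l *: c + A *m col l D.
  apply/colP=> k; rewrite !mxE big_ord1 mulrC; congr (_ + _).
  by apply: eq_bigr => k' _; rewrite mxE.
rewrite !colD mulmxBr -!scalemxAr ![(_ *: r) _ _]mxE.
rewrite scalerBr !(scalerDr, scalerA) opprD addrACA.
by rewrite -!mulrA [r 0 j * r 0 i]mulrC subrr add0r.
Qed.

End BWNumerator.

(** Count of the factors of the [GL_1] entry [x]: the row entries give e + (a - e) = a, the minors
    give a, the determinant gives -a. With [d] the determinant of the [GL_2] block, what remains is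
    the scalar of [actW]. *)
Lemma scale_identity (F : fieldType) (a e : nat) (x d D c r s : F) :
  x != 0 -> (e <= a)%N ->
  (x * d * D) ^- a * (c * (x * r) ^+ e * (x * s) ^+ (a - e)) * x ^+ a
  = x ^+ a * d ^- a * (D ^- a * (c * r ^+ e * s ^+ (a - e))).
Proof.
move=> x0 ea; have xa0 : x ^+ a != 0 by rewrite expf_neq0.
rewrite -!(mulrA c).
have -> : (x * r) ^+ e * (x * s) ^+ (a - e)
    = x ^+ a * (r ^+ e * s ^+ (a - e)).
  by rewrite -[in x ^+ a](subnKC ea) exprD !exprMn mulrACA.
rewrite !exprMn !invfM; move: (r ^+ e * _) (x ^+ a) xa0 => P X X0.
transitivity (X^-1 * X * (X * (d ^+ a)^-1 * ((D ^+ a)^-1 * (c * P)))).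
  by ring.
by rewrite mulVf // mul1r.
Qed.

Section BW.
Variables (K : fieldType) (a e : nat) (i j : 'I_3).

Definition bw (c : K) (al be : 'cV[K]_3) (g : GrpG K) : {mpoly K[2]} :=
  \det (val g.1) ^- a *: bw_num a e i j c al be (val g.1).

Lemma det_neq0 (g : GrpG K) : \det (val g.1) != 0.
Proof. by rewrite -unitfE -unitmxE (unit_valP g.1). Qed.

Lemma unit_neq0 (x : units K) : val x != 0.
Proof. by rewrite -unitfE unit_valP. Qed.

Lemma nbar_leviE c (l : LeviG K) :
  val (nbar c * levi l)%g.1
  = block_mx (val l.1.1)%:M 0 (val l.1.1 *: c) (val l.1.2 : 'M_2) :> 'M_(1 + 2).
Proof.
rewrite [RHS](_ : _ = nbar_mx c *m levi_mx l) //.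
by rewrite /nbar_mx /levi_mx mulmx_block !mul0mx !mulmx0 !mul1mx !addr0
  mul_mx_scalar add0r.
Qed.

Lemma nbar_levi_det c (l : LeviG K) :
  \det (val (nbar c * levi l)%g.1) = val l.1.1 * \det (val l.1.2 : 'M_2).
Proof. by rewrite nbar_leviE (@det_lblock K 1 2) det_scalar1. Qed.

Lemma actW_linform (l : LeviG K) b v :
  actW a l (b *: linform v ^+ a) =
  (val l.1.1 ^+ a * \det (val l.1.2 : 'M_2) ^- a * b) *:
    linform ((val l.1.2 : 'M_2) *m v) ^+ a.
Proof. by rewrite /actW comp_mpolyZ rmorphXn /= comp_linform scalerA. Qed.

Lemma bw_equiv c al be n l g : (e <= a)%N ->
  bw c al be (nbar n * levi l * g)%g = actW a l (bw c al be g).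
Proof.
move=> ea; rewrite /bw /bw_num [in RHS]scalerA actW_linform.
rewrite [val (nbar n * levi l * g)%g.1]/(val (nbar n * levi l)%g.1 *m val g.1).
rewrite det_mulmx nbar_levi_det nbar_leviE toprow_par minors_par linformZ.
rewrite exprZn !scalerA -!scalemxAl ![fun_of_matrix (_ *: _) 0 0]mxE.
congr (_ *: _); exact: scale_identity (unit_neq0 _) ea.
Qed.

End BW.

(** * Integrality of these vectors *)

Section Regular.
Variable R : idomainType.
Local Notation K := {fraction R}.

Definition generic_mx : 'M[{mpoly R[3 * 3 + 1]}]_3 :=
  \matrix_(k, l) 'X_(lshift 1 (mxvec_index k l)).

(** Packaged as a ring morphism so that [map_bw_num] carries the generic numerator to its value at
    [g]. *)
Definition eval_at (g : GrpG K) : {mpoly R[3 * 3 + 1]} -> K :=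
  meval (coords g) \o map_mpoly (@tofrac R).

HB.instance Definition _ g := GRing.RMorphism.on (eval_at g).

Lemma eval_generic_mx g : map_mx (eval_at g) generic_mx = val g.1.
Proof.
apply/matrixP=> k l; rewrite !mxE /eval_at /= map_mpolyX mevalXU.
by rewrite /coords row_mxEl mxvecE.
Qed.

Lemma eval_atC g c : eval_at g c%:MP = tofrac c.
Proof. by rewrite /eval_at /= map_mpolyC mevalC. Qed.

Lemma eval_at_t g : eval_at g 'X_(rshift _ ord0) = val g.2.
Proof.
by rewrite /eval_at /= map_mpolyX mevalXU /coords row_mxEr !mxE.
Qed.

Lemma frac_identity (F : fieldType) (D t x : F) a :
  t != 0 -> D ^- a * x = x * t ^+ a / (D * t) ^+ a.
Proof. by move=> t0; rewrite exprMn invfM mulrCA mulfK ?expf_neq0. Qed.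

(** Since [c], [al] and [be] have entries in [R], each coefficient of the generic numerator is a
    polynomial over [R]; only a power of the determinant is left to invert. *)
Lemma V_lattice_bw a e i j c (al be : 'cV[R]_3) : (e <= a)%N ->
  V_lattice a 0
    (bw a e i j (tofrac c) (map_mx (@tofrac R) al) (map_mx (@tofrac R) be)).
Proof.
move=> ea; split=> [g|m|n l g]; first exact/dhomogZ/bw_num_homog.
  pose Q := bw_num a e i j c%:MP (map_mx (@mpolyC _ R) al)
    (map_mx (@mpolyC _ R) be) generic_mx.
  (* [regular] allows powers of [det B * t] as denominators, so the numerator receives an extra
     [t ^+ a]. *)
  exists (Q@_m * 'X_(rshift _ ord0) ^+ a), a => g.
  rewrite -[(map_mpoly _ _).@[_]]/(eval_at g _) rmorphM rmorphXn /= eval_at_t.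
  rewrite -mcoeff_map_mpoly map_bw_num eval_generic_mx /= eval_atC.
  rewrite -!map_mx_comp !(eq_map_mx _ (eval_atC g)) mcoeffZ.
  exact: frac_identity (unit_neq0 _).
by rewrite bw_equiv // expr0 invr1 scale1r.
Qed.

End Regular.

(** * Regular functions restricted to polynomial curves *)

Lemma nat_roots_poly0 (F : fieldType) (Q : {poly F}) :
  [pchar F] =i pred0 -> (forall n : nat, Q.[n%:R] = 0) -> Q = 0.
Proof.
move=> /pcharf0P F0 Qn; apply/eqP/negP => /negP Q0.
pose rs : seq F := [seq n%:R | n <- iota 0 (size Q)].
have Qrs : all (root Q) rs.
  by apply/allP => _ /mapP[n _ ->]; rewrite /root Qn.
suff /(max_poly_roots Q0 Qrs) : uniq rs by rewrite size_map size_iota ltnn.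
rewrite map_inj_uniq ?iota_uniq // => m n.
wlog le_nm : m n / (n <= m)%N => [wl|].
  by case/orP: (leq_total n m) => le; [|move/esym]; move/(wl _ _ le).
move/eqP; rewrite -subr_eq0 -natrB // F0 subn_eq0 => le_mn.
by apply/eqP; rewrite eqn_leq le_mn.
Qed.

Lemma horner_mmap (F : fieldType) n (c : 'I_n -> {poly F})
    (q : {mpoly F[n]}) s :
  (mmap polyC c q).[s] = q.@[fun i => (c i).[s]].
Proof.
rewrite /mmap horner_sum mevalE; apply: eq_bigr => m _.
rewrite hornerM hornerC /mmap1 horner_prod; congr (_ * _).
by apply: eq_bigr => i _; rewrite horner_exp.
Qed.

Section Curve.
Variable R : idomainType.
Local Notation K := {fraction R}.

(** With the determinant and [t] constant along the curve, the denominator is a constant, so the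
    restriction is a polynomial and not merely a rational function. *)
Lemma regular_curve (phi : GrpG K -> K) (PB : 'M[{poly K}]_3)
    (gs : K -> GrpG K) d t :
  regular phi -> (forall s, val (gs s).1 = map_mx (horner_eval s) PB) ->
  (forall s, \det (val (gs s).1) = d) -> (forall s, val (gs s).2 = t) ->
  exists Q : {poly K}, forall s, phi (gs s) = Q.[s].
Proof.
case=> P [N phiE] gsE gsd gst.
pose c := row_mx (mxvec PB) (t%:P)%:M 0.
exists ((d * t) ^- N *: mmap polyC c (map_mpoly (@tofrac R) P)) => s.
rewrite phiE gsd gst hornerZ mulrC horner_mmap; congr (_ * _).
apply: meval_eq => i; rewrite /coords /c gsE gst.
rewrite -map_mxvec; case: (splitP i) => k ik.
  have -> : i = lshift 1 k by apply: val_inj.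
  by rewrite !row_mxEl mxE.
have -> : i = rshift (3 * 3) k by apply: val_inj.
by rewrite !row_mxEr !mxE !ord1 /= hornerC.
Qed.

End Curve.

(** * Shear curves and the open orbit *)

Section Orbit.
Variable K : fieldType.

(* The curve s |-> shear s * g adds s row_2 + s^2 row_3 to the first row of g
   and preserves det g; each entry of its first row is a nonzero
   polynomial in s. *)
Definition shear_mx (s : K) : 'M[K]_(1 + 2) :=
  block_mx 1%:M (\row_k s ^+ k.+1) 0 1%:M.

Lemma shear_proof s : shear_mx s \in unitmx.
Proof. by rewrite unitmxE det_ublock !det1 mulr1 unitr1. Qed.

Definition shear (s : K) : GrpG K :=
  (@Units 'M[K]_3 (shear_mx s) (shear_proof s), 1%g).

Lemma shear_det s g : \det (val (shear s * g)%g.1) = \det (val g.1).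
Proof.
rewrite [LHS]det_mulmx [X in X * _](@det_ublock K 1 2).
by rewrite !det1 !mul1r.
Qed.

Lemma shear_t s g : val (shear s * g)%g.2 = val g.2.
Proof. exact: mul1r. Qed.

Lemma shear0 g : (shear 0 * g)%g = g.
Proof.
rewrite -[RHS]mul1g; congr (_ * _)%g; congr (_, _); apply: val_inj => /=.
rewrite /shear_mx (_ : \row_k _ = 0) -?(@scalar_mx_block K 1 2) //.
by apply/rowP=> k; rewrite !mxE expr0n.
Qed.

Definition shear_curve (B : 'M[K]_3) : 'M[{poly K}]_3 :=
  (block_mx 1%:M (\row_k 'X ^+ k.+1) 0 1%:M : 'M_(1 + 2)) *m map_mx polyC B.

Lemma shear_curveE g s :
  val (shear s * g)%g.1 = map_mx (horner_eval s) (shear_curve (val g.1)).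
Proof.
rewrite map_mxM -map_mx_comp [LHS]/(shear_mx s *m val g.1); congr (_ *m _).
  rewrite (@map_block_mx _ _ _ 1 2 1 2) !map_mx1 map_mx0 /shear_mx.
  rewrite [map_mx _ (\row_k _)](_ : _ = \row_k s ^+ k.+1) //; apply/rowP=> k.
  by rewrite !mxE /= /horner_eval hornerXn.
by apply/matrixP=> k l; rewrite mxE /= /horner_eval hornerC.
Qed.

(** The three rows enter with the distinct powers 1, X, X^2, so one entry of the top row records a
    whole column of [B]. *)
Lemma shear_curve_coef B (i l : 'I_3) : (shear_curve B 0 l)`_i = B i l.
Proof.
have -> : shear_curve B 0 l =
    ((@usubmx _ 1 2 3 (map_mx polyC B)) +
      (\row_k 'X ^+ k.+1) *m (@dsubmx _ 1 2 3 (map_mx polyC B))) 0 l.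
  rewrite /shear_curve -[map_mx polyC B in LHS](@vsubmxK _ 1 2) mul_block_col.
  rewrite mul1mx (_ : 0 = lshift 2 0 :> 'I_(1 + 2)) ?(@col_mxEu _ 1 2) //.
  exact: val_inj.
rewrite !mxE !big_ord_recl big_ord0 !mxE addr0 !coefD coefC !coefXnM !coefC.
by case: i => [[|[|[|//]]] lti]; rewrite /= ?(addr0, add0r); congr (B _ _);
  apply: val_inj.
Qed.

(** If the polynomial vanished, column [l] of an invertible matrix would be zero. *)
Lemma shear_curve_neq0 (g : GrpG K) l : shear_curve (val g.1) 0 l != 0.
Proof.
apply/eqP=> sc0.
have /(congr1 (fun M : 'M_3 => M l l)) := mulVmx (unit_valP g.1 : _ \in unitmx).
rewrite mxE big1 => [|k _].
  by move/eqP; rewrite !mxE eqxx eq_sym oner_eq0.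
by rewrite -(shear_curve_coef (val g.1)) sc0 coef0 mulr0.
Qed.

Lemma u_inv_mx :
  val (u_elt K)^-1%g.1 = mx3 [:: [:: 1; 0; -1]; [:: 0; 0; 1]; [:: 0; -1; 0]].
Proof.
set X := mx3 _; have uX : val (u_elt K).1 * X = 1.
  apply/matrixP => -[[|[|[|i]]] ?] // -[[|[|[|j]]] ?] //;
  do 3!rewrite ?mxE ?big_ord_recl ?big_ord0 /=;
  by rewrite !(mulr0, mul0r, mulr1, mul1r, addr0, add0r, mulrNN, subrr, addNr,
    oppr0).
by rewrite -[RHS]mul1r -[in RHS](mulVr (unit_valP (u_elt K).1)) -mulrA uX mulr1.
Qed.

Lemma iota_mx3 (q : GrpH K) : in_QH0 q ->
  iota_mx q = mx3 [:: [:: val q.1 0 0; val q.1 0 1; 0]; [:: 0; 1; 0];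
                      [:: 0; 0; val q.2]].
Proof.
case=> q10 q11; apply/matrixP => i j.
case: (split_ordP i) => i' ->; case: (split_ordP j) => j' ->;
  rewrite ?(block_mxEul, block_mxEur, block_mxEdl, block_mxEdr) !mxE ?ord1 //=.
- by case: i' => [[|[|//]] lti]; case: j' => [[|[|//]] ltj] /=;
    rewrite -?q10 -?q11; congr (val q.1 _ _); apply: val_inj.
- by case: i' => [[|[|//]] lti].
- by case: j' => [[|[|//]] lti].
Qed.

(** As [q] varies, the first row (x, y, -z) takes every value whose outer entries are nonzero;
    [open_orbit] relies on this. *)
Lemma u_inv_iota_mx (q : GrpH K) : in_QH0 q ->
  val ((u_elt K)^-1 * Defs.iota q)%g.1 =
    mx3 [:: [:: val q.1 0 0; val q.1 0 1; - val q.2]; [:: 0; 0; val q.2];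
         [:: 0; -1; 0]].
Proof.
move=> qQ; rewrite [LHS]/(val (u_elt K)^-1%g.1 *m (iota_mx q : 'M_3)).
rewrite u_inv_mx iota_mx3 //.
apply/matrixP => -[[|[|[|i]]] ?] // -[[|[|[|j]]] ?] //;
  do 3!rewrite ?mxE ?big_ord_recl ?big_ord0 /=;
  by rewrite ?(mulr0, mul0r, mulr1, mul1r, addr0, add0r, mulN1r).
Qed.

(** This shape covers both u^-1 q and tau^-n u^-1. *)
Lemma det_mx3_corner (x y z t : K) :
  \det (mx3 [:: [:: x; y; z]; [:: 0; 0; t]; [:: 0; -1; 0]]) = x * t.
Proof.
set M := mx3 _; rewrite -[M](@submxK _ 1 2 1 2) (_ : dlsubmx _ = 0); last first.
  by apply/matrixP => -[[|[|//]] ?] l; rewrite !mxE !ord1.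
rewrite (@det_ublock _ 1 2) det_mx11 (expand_det_row _ 0).
rewrite !big_ord_recl big_ord0 /cofactor !det_mx11 !mxE /=.
by rewrite mul0r add0r addr0 add0n expr1 mulrNN !mulr1.
Qed.

Lemma det_u_inv_iota (q : GrpH K) : in_QH0 q ->
  \det (val ((u_elt K)^-1 * Defs.iota q)%g.1) = val q.1 0 0 * val q.2.
Proof. by move=> qQ; rewrite (u_inv_iota_mx qQ) det_mx3_corner. Qed.

Lemma nu1M (g h : GrpG K) : nu1 (g * h)%g = nu1 g * nu1 h.
Proof.
rewrite /nu1 [val (g * h)%g.1]/(val g.1 *m val h.1) det_mulmx.
by rewrite [val (g * h)%g.2]/(val g.2 * val h.2) exprMn invfM mulrACA.
Qed.

Lemma nu1_neq0 (g : GrpG K) : nu1 g != 0.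
Proof.
by rewrite mulf_neq0 ?det_neq0 // invr_neq0 // expf_neq0 // unit_neq0.
Qed.

Lemma nu1_nbar c : nu1 (nbar c : GrpG K) = 1.
Proof.
by rewrite /nu1 [X in X / _](@det_lblock _ 1 2) !det1 mulr1 expr1n divr1.
Qed.

Lemma nu1_u_inv_iota (q : GrpH K) : in_QH0 q ->
  nu1 ((u_elt K)^-1 * Defs.iota q)%g = val q.1 0 0 / val q.2.
Proof.
move=> qQ; rewrite /nu1 det_u_inv_iota //.
have -> : val ((u_elt K)^-1 * Defs.iota q)%g.2 = val q.2.
  by rewrite /= invr1 mul1r.
by rewrite expr2 invfM mulrA mulfK // unit_neq0.
Qed.

(** The first column vanishes below the top row, so the minor vector is [- x] times the second basis
    vector and the value lies on the line of ['X_1 ^+ a]. *)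
Lemma bw_num_mx3 a j (b x y z t : K) :
  bw_num a j 0 1 b (delta_mx 0 0) (delta_mx ord_max 0)
    (mx3 [:: [:: x; y; z]; [:: 0; 0; t]; [:: 0; -1; 0]])
  = (b * x ^+ j * z ^+ (a - j) * (- x) ^+ a) *: 'X_1 ^+ a.
Proof.
set M := mx3 _; have Mx (k : 'I_3) : toprow M 0 k = nth 0 [:: x; y; z] k.
  by rewrite !mxE.
rewrite /bw_num; have -> : minors 0 1 M = (- x) *: delta_mx 1 0.
  apply/colP=> k; rewrite /minors mxE [RHS]mxE !Mx !mxE /=.
  by case: k => [[|[|//]] ?] /=;
    rewrite ?(mulr0, mul0r, mulrN1, subr0, mulr1, oppr0).
rewrite -!colE ![col _ _ 0 0]mxE !Mx /= linformZ exprZn scalerA.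
congr (_ *: _ ^+ a); rewrite /linform !big_ord_recl big_ord0 !mxE /=.
rewrite scale0r add0r addr0 scale1r; congr ('X_ _); exact: val_inj.
Qed.

(** The signs of (-z)^(a-j) and (-x)^a multiply to (-1)^j, which explains the factor (-1)^j in the
    formula for nu_1^j f^{a,j}. *)
Lemma sign_identity (c x z : K) a j : x != 0 -> z != 0 -> (j <= a)%N ->
  (x * z) ^- a * (c * (-1) ^+ j * x ^+ j * (- z) ^+ (a - j) * (- x) ^+ a)
  = (x / z) ^+ j * c.
Proof.
move=> x0 z0 ja; rewrite [in (- z) ^+ _]exprNn [(- x) ^+ _]exprNn.
have -> : c * (-1) ^+ j * x ^+ j * ((-1) ^+ (a - j) * z ^+ (a - j))
    * ((-1) ^+ a * x ^+ a) = ((-1) ^+ j * (-1) ^+ (a - j)) * (-1) ^+ a *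
    (x ^+ a * (z ^+ (a - j) * (x ^+ j * c))) by ring.
rewrite -exprD subnKC // -expr2 sqrr_sign mul1r.
rewrite !exprMn invfM mulrACA mulVf ?expf_neq0 // mul1r.
rewrite -[in z ^+ a](subnK ja) exprD invfM mulrACA.
by rewrite mulVf ?expf_neq0 // mul1r exprVn mulrCA mulrA.
Qed.

(** By invariance, nu_1^j f^{a,j} takes this same value at u^-1 q when w = c 'X_1^a. *)
Lemma bw_u_inv_iota a j (c : K) (q : GrpH K) : (j <= a)%N -> in_QH0 q ->
  bw a j 0 1 (c * (-1) ^+ j) (delta_mx 0 0) (delta_mx ord_max 0)
    ((u_elt K)^-1 * Defs.iota q)%g
  = nu1 ((u_elt K)^-1 * Defs.iota q)%g ^+ j *: (c *: 'X_1 ^+ a).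
Proof.
move=> ja qQ; rewrite (nu1_u_inv_iota qQ) /bw (det_u_inv_iota qQ).
rewrite (u_inv_iota_mx qQ) bw_num_mx3 !scalerA; congr (_ *: _).
apply: sign_identity ja; last exact: unit_neq0.
have := det_neq0 ((u_elt K)^-1 * Defs.iota q)%g.
by rewrite (det_u_inv_iota qQ) mulf_eq0 => /norP[].
Qed.

(** Choose [q] so that u^-1 q has the same first row as [g]. Then g (u^-1 q)^-1 has first row (1, 0,
    0), hence lies in bar N_1 L_1^G. *)
Lemma open_orbit (g : GrpG K) :
  val g.1 0 0 != 0 -> val g.1 0 ord_max != 0 ->
  exists c l q,
    in_QH0 q /\ g = (nbar c * levi l * ((u_elt K)^-1 * Defs.iota q))%g.
Proof.
set B := val g.1; move=> x0 z0.
(* The second row [k%:R] is (0, 1), as membership in Q_H^0 demands. *)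
pose Q : 'M[K]_2 := \matrix_(i, k) (if i == 0 then B 0 (inord k) else k%:R).
have uQ : Q \in unitmx.
  rewrite unitmxE (expand_det_row _ 1) !big_ord_recl big_ord0.
  rewrite /cofactor !det_mx11 !mxE /= mul0r add0r addr0 mul1r unitfE.
  rewrite exprD expr1 mulrNN !mulr1 mul1r (_ : inord _ = 0) //.
  by apply: val_inj; rewrite /= inordK.
have uz : - B 0 ord_max \is a GRing.unit by rewrite unitfE oppr_eq0.
pose q : GrpH K := (@Units 'M[K]_2 Q uQ, Units uz).
have qQ : in_QH0 q by split; rewrite mxE.
pose h := ((u_elt K)^-1 * Defs.iota q)%g.
pose H : 'M[K]_3 := val h.1.
pose M : 'M[K]_(1 + 2) := val (g * h^-1)%g.1.
have MB : M *m H = B.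
  by rewrite -[LHS]/(val (g * h^-1 * h)%g.1) mulgVK.
have hU : H \in unitmx := unit_valP h.1.
have topB : @usubmx _ 1 2 3 B = (row_mx 1%:M 0 : 'M_(1, 1 + 2)) *m H.
  rewrite /H (u_inv_iota_mx qQ) -[X in _ *m X](@vsubmxK _ 1 2) mul_row_col.
  rewrite mul1mx mul0mx addr0; apply/rowP=> k; rewrite !mxE /= opprK.
  by case: k => [[|[|[|//]]] ltk] /=; congr (B _ _); apply: val_inj;
    rewrite /= ?inordK.
have topM : usubmx M = row_mx 1%:M 0.
  by rewrite -[LHS](mulmxK hU) mul_usub_mx MB topB mulmxK.
pose c := @dlsubmx _ 1 2 1 2 M; pose A := @drsubmx _ 1 2 1 2 M.
have ME : M = block_mx 1%:M 0 c A.
  by rewrite -[LHS]submxK /ulsubmx /ursubmx topM row_mxKl row_mxKr.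
have uA : A \in unitmx.
  have : M \in unitmx by exact: (unit_valP (g * h^-1)%g.1).
  by rewrite !unitmxE ME det_lblock det1 mul1r.
exists c, (1%g, @Units 'M[K]_2 A uA, (g * h^-1)%g.2), q; split=> //.
rewrite -[g in LHS](mulgVK h); congr (_ * _)%g.
rewrite [LHS]surjective_pairing [RHS]surjective_pairing; congr (_, _).
  by apply: val_inj; rewrite nbar_leviE -/M ME /= scale1r.
by rewrite [RHS]mul1g.
Qed.

End Orbit.

Lemma actWZ (K : fieldType) a (l : LeviG K) b w :
  actW a l (b *: w) = b *: actW a l w.
Proof. by rewrite /actW comp_mpolyZ !scalerA mulrC. Qed.

(** * Determination of f^{a,j} from its value at u^-1 *)

Section Uniqueness.
Variable R : idomainType.
Local Notation K := {fraction R}.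

(** Along the shear curve both sides are polynomials in [s] that agree wherever the curve meets the
    open set; the point [g] itself is [s = 0]. *)
Lemma eq_on_curve (phi psi : GrpG K -> K) (b : K) g :
  [pchar K] =i pred0 -> regular phi -> regular psi ->
  (forall s, val (shear s * g)%g.1 0 0 != 0 ->
     val (shear s * g)%g.1 0 ord_max != 0 ->
     b * phi (shear s * g)%g = psi (shear s * g)%g) ->
  b * phi g = psi g.
Proof.
move=> K0 rphi rpsi eq_open; set B := val g.1.
have [P phiE] := regular_curve rphi (shear_curveE g)
  (fun s => shear_det s g) (fun s => shear_t s g).
have [Q psiE] := regular_curve rpsi (shear_curveE g)
  (fun s => shear_det s g) (fun s => shear_t s g).
have sE s k : val (shear s * g)%g.1 0 k = (shear_curve B 0 k).[s].
  by rewrite shear_curveE mxE.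
(* The two extra factors vanish exactly where the curve leaves the open set, so the product is zero
   at every natural number; being nonzero polynomials, they can then be cancelled. *)
have /eqP : shear_curve B 0 0 * shear_curve B 0 ord_max * (b *: P - Q) = 0.
  apply: nat_roots_poly0 K0 _ => n.
  rewrite !hornerM hornerD hornerN hornerZ -phiE -psiE -!sE.
  have [->|s0] := eqVneq (val (shear n%:R * g)%g.1 0 0) 0.
    by rewrite !mul0r.
  have [->|s2] := eqVneq (val (shear n%:R * g)%g.1 0 ord_max) 0.
    by rewrite mulr0 mul0r.
  by rewrite eq_open // subrr mulr0.
rewrite !mulf_eq0 !(negPf (shear_curve_neq0 _ _)) subr_eq0 => /eqP bPQ.
by rewrite -[g]shear0 phiE psiE -bPQ hornerZ.
Qed.

Lemma is_f_formula a j (c : R) f g :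
  [pchar K] =i pred0 -> (j <= a)%N -> is_f a j (tofrac c *: 'X_1 ^+ a) f ->
  nu1_mul j f g = bw a j 0 1 (tofrac (c * (-1) ^+ j))
    (map_mx (@tofrac R) (delta_mx 0 0))
    (map_mx (@tofrac R) (delta_mx ord_max 0)) g.
Proof.
move=> K0 ja [[_ freg feq] finv fu].
set E := bw _ _ _ _ _ _ _.
have [_ Ereg _] : V_lattice a 0 E by exact: V_lattice_bw.
have eq_open (h : GrpG K) : val h.1 0 0 != 0 -> val h.1 0 ord_max != 0 ->
    nu1_mul j f h = E h.
  move=> h0 h2; have [n [l [q [qQ ->]]]] := open_orbit h0 h2.
  (* The factor nu_1(l)^j split off here cancels the twist nu_1^-j in the equivariance of [f]. *)
  rewrite /nu1_mul nu1M [nu1 (nbar n * levi l)%g]nu1M nu1_nbar mul1r.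
  rewrite feq (finv q qQ) fu /E (bw_equiv _ _ _ _ _ _ _ _ ja) !map_delta_mx.
  rewrite rmorphM rmorph_sign (bw_u_inv_iota _ ja qQ) [in RHS]actWZ scalerA.
  by rewrite exprMn mulrAC mulfV ?mul1r // expf_neq0 // nu1_neq0.
apply/mpolyP => m; rewrite mcoeffZ.
apply: (eq_on_curve K0 (freg m) (Ereg m)) => s h0 h2.
(* [nu1] depends only on the determinant and [t], so its power is the constant [b] along the
   curve. *)
rewrite -eq_open // /nu1_mul mcoeffZ; congr (_ ^+ j * _).
by rewrite /nu1 shear_det shear_t.
Qed.

End Uniqueness.

(** * Characteristic zero and the lowest weight line *)

Lemma pchar_padic_rat (p : nat) (p_pr : prime p) :
  [pchar padic_rat p_pr] =i pred0.
Proof.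
apply/pcharf0P => n; rewrite -(rmorph_nat (@tofrac _)) tofrac_eq0.
apply/idP/eqP => [/eqP n0|->]; last by rewrite mulr0n.
(* Level [n] suffices because n < p^n, so the residue of [n] there is [n] itself. *)
have := approx_nat p_pr n n; rewrite n0 /= mod0z modz_small; first by case.
by rewrite /= ltz_nat ltn_expl // prime_gt1.
Qed.

Lemma mcoeff_comp_diag (K : comNzRingType) n (d : 'I_n -> K)
    (w : {mpoly K[n]}) m :
  (comp_mpoly [tuple d i *: 'X_i | i < n] w)@_m = \prod_i d i ^+ m i * w@_m.
Proof.
rewrite comp_mpolyEX [w in RHS]mpolyE !raddf_sum mulr_sumr /=.
apply: eq_bigr => m' _.
have -> : comp_mpoly [tuple d i *: 'X_i | i < n] 'X_[m']
    = (\prod_i d i ^+ m' i) *: 'X_[m'].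
  rewrite comp_mpolyX [in RHS]mpolyXE_id -scaler_prod.
  by apply: eq_bigr => i _; rewrite tnth_mktuple exprZn.
rewrite !mcoeffZ mcoeffX; have [->|_] := eqVneq m' m; last by rewrite !mulr0.
by rewrite !mulr1 mulrC.
Qed.

(** The torus element diag(2, 1) scales the coefficient at [m] by 2^(m_0 - a), whereas the weight
    prescribes 2^-a. In characteristic zero this forces m_0 = 0, and homogeneity leaves only
    'X_1^a. *)
Lemma lowest_weight_monomial (K : fieldType) a (w : {mpoly K[2]}) :
  [pchar K] =i pred0 -> w \is (a.-homog) ->
  (forall l : LeviG K, is_diag_mx (val l.1.2) ->
    actW a l w = (val l.1.1 ^+ a * val l.1.2 0 0 ^- a) *: w) ->
  w = w@_(U_(1) *+ a)%MM *: 'X_1 ^+ a.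
Proof.
move=> /pcharf0P K0 whom wt.
have two0 : (2 : K) != 0 by rewrite K0.
pose d (i : 'I_2) : K := if i == 0 then 2 else 1.
pose D : 'M[K]_2 := diag_mx (\row_i d i).
have detD : \det D = 2.
  by rewrite det_diag !big_ord_recl big_ord0 !mxE /= !mulr1.
have uD : D \in unitmx by rewrite unitmxE detD unitfE.
have w_m0 (m : 'X_{1..2}) : m 0 != 0%N -> w@_m = 0.
  move=> m0.
  have := wt (1%g, @Units 'M_2 D uD, 1%g) (diag_mx_is_diag _).
  move/(congr1 (fun v => v@_m)); rewrite /actW !mcoeffZ /= detD expr1n !mul1r.
  have -> : [tuple \sum_(k < 2) D k i *: 'X_k | i < 2]
      = [tuple d i *: 'X_i : {mpoly K[2]} | i < 2].
    apply: eq_from_tnth => i; rewrite !tnth_mktuple (bigD1 i) //= big1.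
      by rewrite addr0 !mxE eqxx.
    by move=> k ki; rewrite !mxE (negPf ki) scale0r.
  rewrite mcoeff_comp_diag !mxE /= !big_ord_recl big_ord0 /= expr1n !mulr1.
  rewrite [d _]/= mulr1n => /(mulfI (invr_neq0 (expf_neq0 a two0)))/eqP.
  rewrite -[X in _ == X]mul1r -subr_eq0 -mulrBl mulf_eq0 => /orP[|/eqP//].
  have -> : 2 ^+ m 0 - 1 = (2 ^ m 0 - 1)%:R :> K.
    by rewrite natrB ?expn_gt0 // natrX.
  by rewrite K0 subn_eq0 leqNgt -{1}(expn0 2)
    ltn_exp2l // lt0n m0.
apply/mpolyP => m; rewrite mcoeffZ mpolyXn mcoeffX.
have [<-|nm] := eqVneq; first by rewrite mulr1.
rewrite mulr0; have [m0|/w_m0//] := eqVneq (m 0) 0%N.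
apply: (dhomog_nemf_coeff whom); apply: contraNneq nm => /= <-.
apply/eqP/mnmP => i; rewrite mulmnE mnm1E mdegE !big_ord_recl big_ord0 m0.
case: eqVneq => [<-|].
  by rewrite mul1n add0n addn0; congr (m _); apply: val_inj.
move=> i1; rewrite mul0n -[LHS]m0; congr (m _); apply: val_inj.
by case: i i1 => [[|[|//]] lti].
Qed.

(** * Translation by tau^-n u^-1 and the binomial sum *)

Lemma tau_expg_mx (K : fieldType) (x : units K) n :
  val (tau x ^+ n)%g.1
  = mx3 [:: [:: val x ^+ n; 0; 0]; [:: 0; 1; 0]; [:: 0; 0; 1]].
Proof.
elim: n => [|n IHn].
  by apply/matrixP => -[[|[|[|i]]] ?] // -[[|[|[|j]]] ?] //; rewrite !mxE.
rewrite expgS [LHS]/(val (tau x).1 *m val (tau x ^+ n)%g.1) IHn.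
apply/matrixP => -[[|[|[|i]]] ?] // -[[|[|[|j]]] ?] //;
  by rewrite !mxE !big_ord_recl big_ord0 !mxE /= ?exprS
    ?(mulr0, mul0r, mulr1, mul1r, addr0, add0r).
Qed.

Lemma tau_u_inv_mx (K : fieldType) (x : units K) n :
  let s := val x ^- n in
  val (tau x ^- n * (u_elt K)^-1)%g.1
  = mx3 [:: [:: s; 0; - s]; [:: 0; 0; 1]; [:: 0; -1; 0]].
Proof.
move=> s; set M := mx3 _.
have x0 : val x ^+ n != 0 by rewrite expf_neq0 ?unit_neq0.
have tM : val (tau x ^+ n)%g.1 *m M = val (u_elt K)^-1%g.1.
  rewrite tau_expg_mx u_inv_mx.
  apply/matrixP => -[[|[|[|i]]] ?] // -[[|[|[|j]]] ?] //;
  by rewrite !mxE !big_ord_recl big_ord0 !mxE /= ?mulrN ?mulfV //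
    ?(mulr0, mul0r, mulr1, mul1r, addr0, add0r, oppr0).
have VT : (val (tau x ^- n)%g.1 : 'M_3) *m val (tau x ^+ n)%g.1 = 1%:M.
  have /(congr1 (fun g : GrpG K => val g.1)) := mulVg (tau x ^+ n)%g.
  exact.
transitivity ((val (tau x ^- n)%g.1 : 'M_3) *m (val (tau x ^+ n)%g.1 *m M)).
  by rewrite tM.
by rewrite mulmxA VT mul1mx.
Qed.

(** The columns s b_1 and -b_3 give the minor vector -s m_13. It does not involve [j], so the
    alternating sum becomes a sum of scalars. *)
Lemma bw_num_tau_u_inv (K : fieldType) a j (b s : K) (B : 'M[K]_3) :
  bw_num a j 0 1 b (delta_mx 0 0) (delta_mx ord_max 0)
    (B *m mx3 [:: [:: s; 0; - s]; [:: 0; 0; 1]; [:: 0; -1; 0]])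
  = (b * (s * toprow B 0 0) ^+ j * (toprow B 0 1 - s * toprow B 0 0) ^+ (a - j)
       * (- s) ^+ a) *: linform (minors 0 ord_max B) ^+ a.
Proof.
set N := mx3 _.
have topE : toprow (B *m N) = toprow B *m N by exact/esym/(@mul_usub_mx _ 1 2).
have botE : bottomrows (B *m N) = bottomrows B *m N.
  exact/esym/(@mul_dsub_mx _ 1 2).
have N0 : col 0 N = s *: delta_mx 0 0.
  apply/colP=> k; rewrite !mxE; case: k => [[|[|[|//]]] ?] /=;
  by rewrite ?mulr1 ?mulr0.
have N1 : col 1 N = - delta_mx ord_max 0.
  apply/colP=> k; rewrite !mxE; case: k => [[|[|[|//]]] ?] /=;
  by rewrite ?oppr0.
have N2 : col ord_max N = delta_mx 1 0 - s *: delta_mx 0 0.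
  apply/colP=> k; rewrite !mxE; case: k => [[|[|[|//]]] ?] /=;
  by rewrite ?mulr1 ?mulr0 ?subr0 ?sub0r.
have colN m (A : 'M[K]_(m, 3)) k : col k (A *m N) = A *m col k N.
  by rewrite !colE mulmxA.
have entN k : toprow (B *m N) 0 k = (toprow B *m col k N) 0 0.
  by rewrite topE -colN [RHS]mxE.
rewrite /bw_num -!colE ![col _ _ 0 0]mxE.
have top0 : toprow (B *m N) 0 0 = s * toprow B 0 0.
  by rewrite entN N0 -scalemxAr -colE !mxE.
have top1 : toprow (B *m N) 0 1 = - toprow B 0 ord_max.
  by rewrite entN N1 mulmxN -colE !mxE.
have top2 : toprow (B *m N) 0 ord_max = toprow B 0 1 - s * toprow B 0 0.
  by rewrite entN N2 mulmxBr -scalemxAr -!colE !mxE.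
have -> : minors 0 1 (B *m N) = (- s) *: minors 0 ord_max B.
  rewrite /minors top0 top1 botE !colN N0 N1 mulmxN -scalemxAr -!colE.
  rewrite scalerN !scaleNr scalerBr !scalerA opprK opprB addrC.
  by rewrite [toprow B 0 ord_max * s]mulrC.
by rewrite top0 top2 linformZ exprZn scalerA.
Qed.

(** Here P = p^n and s = p^-n. With z = y - s x, the signs square away and the sum is z^(a-k) (z + s
    x)^k = z^(a-k) y^k. Of P^a, the part P^(a-k) clears the denominators of z^(a-k), and P^k is the
    divisibility gained. *)
Lemma binomial_identity (K : fieldType) a k (P s c D x y : K) :
  s * P = 1 -> (k <= a)%N ->
  \sum_(0 <= j < k.+1) 'C(k, j)%:R * ((-1) ^+ j * (P ^+ a * ((s * D) ^- a *
    (c * (-1) ^+ j * (s * x) ^+ j * (y - s * x) ^+ (a - j) * (- s) ^+ a))))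
  = P ^+ k * (D ^- a * (c * (-1) ^+ a * y ^+ k * (P * y - x) ^+ (a - k))).
Proof.
move=> sP ka; have s0 : s != 0.
  by apply: contra_eq_neq sP => ->; rewrite mul0r eq_sym oner_eq0.
set z := y - s * x.
transitivity (P ^+ a * D ^- a * c * (-1) ^+ a * (z ^+ (a - k) *
    \sum_(0 <= j < k.+1) (z ^+ (k - j) * (s * x) ^+ j) *+ 'C(k, j))).
  rewrite !mulr_sumr; apply: eq_big_nat => j /andP[_ jk].
  rewrite [(- s) ^+ a]exprNn exprMn invfM.
  have -> : (a - j = (a - k) + (k - j))%N by rewrite addnBA // subnK.
  rewrite exprD; set S := _%:R.
  transitivity (((-1) ^+ j * (-1) ^+ j) * (s ^- a * s ^+ a) *
    (P ^+ a * D ^- a * c * (-1) ^+ a *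
    (z ^+ (a - k) * (S * (z ^+ (k - j) * (s * x) ^+ j))))); first by ring.
  by rewrite -expr2 sqrr_sign mulVf ?expf_neq0 // !mul1r mulr_natl.
rewrite big_mkord -exprDn subrK.
have -> : P * y - x = P * z by rewrite mulrBr mulrA [P * s]mulrC sP mul1r.
by rewrite -[in P ^+ a](subnKC ka) exprD exprMn; ring.
Qed.

Lemma bw_tau_u_inv (K : fieldType) a j (b : K) (x : units K) n (g : GrpG K) :
  let s := val x ^- n in let r := toprow (val g.1) in
  bw a j 0 1 b (delta_mx 0 0) (delta_mx ord_max 0)
    (g * tau x ^- n * (u_elt K)^-1)%g
  = ((s * \det (val g.1)) ^- a *
      (b * (s * r 0 0) ^+ j * (r 0 1 - s * r 0 0) ^+ (a - j) * (- s) ^+ a))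
    *: linform (minors 0 ord_max (val g.1)) ^+ a.
Proof.
move=> s r; rewrite -mulgA /bw.
rewrite [val _]/(val g.1 *m val (tau x ^- n * (u_elt K)^-1)%g.1).
rewrite tau_u_inv_mx bw_num_tau_u_inv det_mulmx det_mx3_corner mulr1 scalerA.
by rewrite [\det _ * _]mulrC.
Qed.

(** The quotient by [x ^ (n * k)] is again a [bw], and for x = p its covectors are integral, so
    [V_lattice_bw] applies to it. *)
Lemma binomial_bw (K : fieldType) a k (c : K) (x : units K) n (g : GrpG K) :
  (k <= a)%N ->
  \sum_(0 <= j < k.+1) ('C(k, j)%:R * (-1) ^+ j) *: (val x ^+ (a * n) *:
    bw a j 0 1 (c * (-1) ^+ j) (delta_mx 0 0) (delta_mx ord_max 0)
      (g * tau x ^- n * (u_elt K)^-1)%g)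
  = val x ^+ (n * k) *: bw a k 0 ord_max (c * (-1) ^+ a) (delta_mx 1 0)
      (val x ^+ n *: delta_mx 1 0 - delta_mx 0 0) g.
Proof.
move=> ka.
under eq_bigr => j _ do rewrite bw_tau_u_inv !scalerA -mulrA mulnC exprM.
rewrite -scaler_suml binomial_identity //; last first.
  by rewrite mulVf // expf_neq0 // unit_neq0.
rewrite /bw /bw_num mulmxBr -scalemxAr -!colE.
rewrite [fun_of_matrix (_ - _) 0 0]mxE [fun_of_matrix (- _) 0 0]mxE.
rewrite [fun_of_matrix (_ *: _) 0 0]mxE ![fun_of_matrix (col _ _) 0 0]mxE.
by rewrite !scalerA exprM mulrA.
Qed.

Theorem proposition2p4p4 (p : nat) (p_pr : prime p) (p_odd : odd p) (a : nat)
    (w : {mpoly (padic_rat p_pr)[2]})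
    (hw : lowest_weight_generator a w)
    (f : nat -> GrpG (padic_rat p_pr) -> {mpoly (padic_rat p_pr)[2]})
    (hf : forall j : nat, (j <= a)%N -> is_f a j w (f j))
    (k n : nat) (hk : (k <= a)%N) (hn : (1 <= n)%N) :
  exists h : GrpG (padic_rat p_pr) -> {mpoly (padic_rat p_pr)[2]},
    V_lattice a 0 h /\
    forall g : GrpG (padic_rat p_pr),
      \sum_(0 <= j < k.+1)
         (('C(k, j))%:R * (-1) ^+ j) *:
           tau_star a n (rtrans (u_elt (padic_rat p_pr))^-1%g (nu1_mul j (f j))) g
      = (p ^ (n * k))%:R *: h g.
Proof.
have K0 := pchar_padic_rat p_pr.
have [[[whom [w0 wE]] wt] _] := hw.
have [c wc] : exists c, w = tofrac c *: 'X_1 ^+ a.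
  (* The scalar is a coefficient of the integral lift [w0], hence lies in Z_p. *)
  exists w0@_(U_(1) *+ a)%MM.
  by rewrite -mcoeff_map_mpoly -wE; exact: lowest_weight_monomial.
(* The witness is the [bw] on the right of [binomial_bw] at x = p, written with covectors over
   Z_p. *)
exists (bw a k 0 ord_max (tofrac (c * (-1) ^+ a))
  (map_mx (@tofrac _) (delta_mx 1 0))
  (map_mx (@tofrac _) ((p ^ n)%:R *: delta_mx 1 0 - delta_mx 0 0))).
split=> [|g]; first exact: V_lattice_bw.
rewrite map_mxB map_mxZ !map_delta_mx rmorphM rmorph_sign rmorph_nat !natrX.
rewrite -(binomial_bw _ (p_unit p_pr) n g hk); apply: eq_big_nat.
move=> j /andP[_ jk]; have ja : (j <= a)%N.
  by apply: leq_trans hk; rewrite -ltnS.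
have fj : is_f a j (tofrac c *: 'X_1 ^+ a) (f j) by rewrite -wc; exact: hf.
rewrite /tau_star /rtrans (is_f_formula _ K0 ja fj).
by rewrite !map_delta_mx rmorphM rmorph_sign.
Qed.
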